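(* Suppose that $\epsilon>0$. Then the set of all $x\in(0,\infty)$ such that for every integer $k$ with $0\leq k\leq \frac{1}{1-\frac{\log_2 3}{2}}\log_2 x$ one has $$\Big(\frac{3^{1/2}}{2}\Big)^k x^{1-\epsilon}\leq C_{\mathbb R}^k(x)\leq \Big(\frac{3^{1/2}}{2}\Big)^k x^{1+\epsilon}$$ is real $*$-dense.
   Context: For $x\in\mathbb R$ let $[x]$ be the unique integer with $x-[x]\in(-\frac12,\frac12]$. The map $C_{\mathbb R}$ is defined by $C_{\mathbb R}(x)=\frac{x}{2}$ if $[x]$ is even and $C_{\mathbb R}(x)=\frac{3x}{2}$ if $[x]$ is odd; it maps $(0,\infty)$ to itself, and $C_{\mathbb R}^k$ is its $k$-th iterate. Let $\lambda$ be Lebesgue measure. A (measurable) set $A\subseteq\mathbb R$ has real $(C,D)$-density if $C>0$, $0<D<1$, and $\frac{\lambda((0,R)\cap A)}{R}\geq 1-\frac{C}{R^D}$ for all $R\in(0,\infty)$. $A$ is real $*$-dense if it has real $(C,D)$-density for some $C>0$ and $0<D<1$. *)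

(* Defs.v *)
From mathcomp Require Import all_boot all_order all_algebra.
From mathcomp Require Import all_classical all_reals all_analysis.
From mathcomp Require Import measurable_realfun lra.

Set Implicit Arguments.
Unset Strict Implicit.
Unset Printing Implicit Defensive.

Import Order.TTheory GRing.Theory Num.Theory.
Import numFieldNormedType.Exports.

Local Open Scope classical_set_scope.
Local Open Scope ring_scope.

Definition nearest_int (R : realType) (x : R) : int := Num.ceil (x - 2^-1).

Lemma nearest_intP (R : realType) (x : R) (n : int) :
  (- 2^-1 < x - n%:~R <= 2^-1) <-> n = nearest_int x.
Proof.
rewrite /nearest_int; split=> [/andP[n1 n2]|->].
  by apply/esym/ceil_def; rewrite intrB; apply/andP; split; lra.
by have := ceil_itv (x - 2^-1); rewrite intrB => /andP[c1 c2];
  apply/andP; split; lra.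
Qed.

Definition collatz_real (R : realType) (x : R) : R :=
  if (2 %| nearest_int x)%Z then x / 2 else 3 * x / 2.

Definition log2 (R : realType) (x : R) : R := ln x / ln 2.

(* Lebesgue measurability: union of a Borel set and a Lebesgue-null set; by
   [completed_caratheodory_measurable], the domain of
   [completed_lebesgue_measure]. *)
Definition lebesgue_measurable (R : realType) (A : set R) : Prop :=
  completed_algebra_gen (@lebesgue_measure R) A.

Definition real_density (R : realType) (C D : R) (A : set R) : Prop :=
  [/\ lebesgue_measurable A, 0 < C, 0 < D < 1 &
   forall r : R, 0 < r ->
     ((1 - C / r `^ D)%:E <=
       completed_lebesgue_measure ([set` `]0%R, r[] `&` A) / r%:E)%E].

Definition real_star_dense (R : realType) (A : set R) : Prop :=
  exists C D : R, real_density C D A.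

(* Main.v *)
(* The orbits of x and x + 2 ^ k n have the same parities at their first k steps,
   and at step k the parities agree exactly when n is even. So, for every x, the
   parity vectors of x + m, m < 2 ^ k, are all distinct, and a Chernoff bound shows that
   the points whose k-vector is not nearly balanced have density exponentially
   small in k. A range of 4.8 log2 x steps is much longer than the log2 x steps
   this controls, so it is cut into a bounded number of blocks of l steps, where
   2 ^ (M l) is about r. As long as the earlier blocks are balanced, the iterate
   at the start of a block is a multiple 3 ^ s / 2 ^ j of x determined by s alone,
   so at most j + 1 linear maps occur, and each transports the exponentially small
   bound back to (0, r) provided the iterate is still of size at least 2 ^ l. The
   last few steps are too few to matter. *)

Require Import Defs.
From mathcomp Require Import all_boot all_order all_algebra.
From mathcomp Require Import all_classical all_reals all_analysis.
From mathcomp Require Import measurable_realfun ring lra.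

Import Order.TTheory GRing.Theory Num.Theory.
Import numFieldNormedType.Exports.

Local Open Scope classical_set_scope.
Local Open Scope ring_scope.

(** * Parities along an orbit and their behaviour under integer translation *)

Lemma dvdz2_addn (m : int) (n : nat) :
  (2 %| m + n%:Z)%Z = (2 %| m)%Z (+) odd n.
Proof.
have succ (p : int) : (2 %| p + 1)%Z = ~~ (2 %| p)%Z.
  case: p => p; first by rewrite -PoszD !dvdzE !absz_nat !dvdn2 addn1.
  rewrite NegzE -addn1 PoszD opprD addrNK !dvdzE !abszN absz_nat -opprD abszN -PoszD.
  by rewrite !absz_nat !dvdn2 addn1 /= negbK.
elim: n => [|n IH]; first by rewrite addr0 addbF.
by rewrite -addn1 PoszD addrA succ IH addn1 /= addbN.
Qed.

Definition odd_step {R : realType} (x : R) : bool := ~~ (2 %| nearest_int x)%Z.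

Definition odd_steps {R : realType} (k : nat) (x : R) : nat :=
  \sum_(i < k) odd_step (iter i (@collatz_real R) x).

Lemma odd_step_addn (R : realType) (x : R) (n : nat) :
  odd_step (x + n%:R) = odd_step x (+) odd n.
Proof.
have -> : odd_step (x + n%:R) = ~~ (2 %| nearest_int x + n%:Z)%Z.
  rewrite /odd_step; congr (~~ (_ %| _)%Z); apply/esym/nearest_intP.
  have /nearest_intP/andP[h1 h2] := erefl (nearest_int x).
  by rewrite intrD -pmulrn; apply/andP; split; lra.
by rewrite dvdz2_addn -addNb.
Qed.

Lemma collatz_realE (R : realType) (x : R) :
  collatz_real x = 3 ^+ odd_step x * x / 2.
Proof.
by rewrite /collatz_real /odd_step; case: ifP => _ /=; rewrite ?expr0 ?expr1 ?mul1r.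
Qed.

Lemma odd_stepsS (R : realType) (k : nat) (x : R) :
  odd_steps k.+1 x = (odd_steps k x + odd_step (iter k (@collatz_real R) x))%N.
Proof. by rewrite /odd_steps big_ord_recr. Qed.

Lemma odd_stepsD (R : realType) (j k : nat) (x : R) :
  odd_steps (j + k) x = (odd_steps j x + odd_steps k (iter j (@collatz_real R) x))%N.
Proof.
elim: k => [|k IH]; first by rewrite addn0 {3}/odd_steps big_ord0 addn0.
by rewrite addnS !odd_stepsS IH -addnA -iterD (addnC k).
Qed.

Lemma leq_odd_steps (R : realType) (k : nat) (x : R) : (odd_steps k x <= k)%N.
Proof.
elim: k => [|k IH]; first by rewrite /odd_steps big_ord0.
by rewrite odd_stepsS -addn1 leq_add// leq_b1.
Qed.

(** Both branches are linear without constant term, so the order of the parities does not matter,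
    only the number of odd ones. *)
Lemma iter_collatz_real (R : realType) (k : nat) (x : R) :
  iter k (@collatz_real R) x = 3 ^+ odd_steps k x / 2 ^+ k * x.
Proof.
elim: k => [|k IH]; first by rewrite /odd_steps big_ord0 !expr0 divr1 mul1r.
rewrite iterS collatz_realE odd_stepsS {2}IH exprD exprS.
by field; rewrite expf_neq0.
Qed.

(** In the induction the shift [2 ^ k.+1 * n] is read as [2 ^ k * (2 * n)]: the [k]-th iterate then
    moves by an even integer, which keeps its parity and stays an integer after halving. *)
Lemma iter_collatz_real_addn (R : realType) (k n : nat) (x : R) :
  odd_steps k (x + (2 ^ k * n)%:R) = odd_steps k x /\
  iter k (@collatz_real R) (x + (2 ^ k * n)%:R) =
    iter k (@collatz_real R) x + (3 ^ odd_steps k x * n)%:R.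
Proof.
elim: k n => [|k IH] n; first by rewrite /odd_steps !big_ord0.
have [e1 e2] := IH (2 * n)%N; rewrite mulnA -expnSr in e1 e2.
have eo : odd_step (iter k (@collatz_real R) (x + (2 ^ k.+1 * n)%:R))
    = odd_step (iter k (@collatz_real R) x).
  by rewrite e2 odd_step_addn !oddM /= andbF addbF.
rewrite !odd_stepsS eo e1; split=> //.
by rewrite !iterS !collatz_realE eo e2 expnD !natrM !natrX; field.
Qed.

(** Moment generating function of the parity walk. The translates by [m] and [m + 2 ^ k] agree
    during the first [k] steps and have opposite parities at step [k], the shift there being an odd
    power of 3; each such pair contributes the factor [expR u + expR (- u)]. *)
Lemma sum_odd_steps (R : realType) (k : nat) (u x : R) :
  \sum_(0 <= m < 2 ^ k) expR (u * ((odd_steps k (x + m%:R))%:R *+ 2 - k%:R)) =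
  (expR u + expR (- u)) ^+ k.
Proof.
elim: k => [|k IH].
  by rewrite big_nat1 /odd_steps big_ord0 mul0rn subr0 mulr0 expR0 expr0.
rewrite exprSr -IH expnS mul2n -addnn (@big_cat_nat _ _ _ (2 ^ k))//= ?leq_addr//.
rewrite -{2}[(2 ^ k)%N]add0n big_addn addnK -big_split/= big_distrl/=.
apply: eq_bigr => m _; rewrite !odd_stepsS.
have [e1 e2] := iter_collatz_real_addn R k 1 (x + m%:R).
rewrite muln1 -addrA -natrD in e1 e2.
rewrite e1 e2 odd_step_addn muln1 oddX orbT addbT [RHS]mulrDr -!expRD.
rewrite -[k.+1]addn1 !natrD.
by case: odd_step => /=; [|rewrite addrC]; congr (_ + _); congr expR; ring.
Qed.

(** * Chernoff bound for the parity vectors *)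

(** The quantity inside the absolute value is the number of odd steps minus the number of even
    steps. *)
Definition unbalanced {R : realType} (t : R) (k : nat) (x : R) : bool :=
  t * k%:R < `|(odd_steps k x)%:R *+ 2 - k%:R|.

(** With [u = t / 2] and [v = u ^+ 2], the inequality [1 + y <= expR y] bounds the hyperbolic cosine
    of [u] by [1 / (1 - v)] and [expR (- (u * t))] by [1 / (1 + 2 * v)]. The product is below 1
    because [0 < v <= 1 / 4]. *)
Lemma chernoff_base (R : realType) (t : R) : 0 < t <= 1 ->
  0 < expR (- (t / 2 * t)) * ((expR (t / 2) + expR (- (t / 2))) / 2) < 1.
Proof.
move=> /andP[t0 t1].
have [u ut] : exists u, u = t / 2 by exists (t / 2).
have u0 : 0 < u by lra.
have u1 : u <= 2^-1 by lra.
rewrite -ut.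
have e1 : expR u <= (1 - u)^-1.
  rewrite -[expR u]invrK -expRN lef_pV2 ?posrE ?expR_gt0//; last lra.
  exact: expR_ge1Dx.
have e2 : expR (- u) <= (1 + u)^-1.
  by rewrite expRN lef_pV2 ?posrE ?expR_gt0//; [exact: expR_ge1Dx | lra].
have e3 : expR (- (u * t)) <= (1 + u * t)^-1.
  rewrite expRN lef_pV2 ?posrE ?expR_gt0//; first exact: expR_ge1Dx.
  by apply: addr_gt0 => //; apply: mulr_gt0; lra.
have c0 : 0 < (expR u + expR (- u)) / 2 by rewrite divr_gt0// addr_gt0 ?expR_gt0.
rewrite mulr_gt0 ?expR_gt0//=.
have c1 : (expR u + expR (- u)) / 2 <= (1 - u ^+ 2)^-1.
  apply: (@le_trans _ _ (((1 - u)^-1 + (1 + u)^-1) / 2)); first by lra.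
  rewrite le_eqVlt; apply/orP; left; apply/eqP; field.
  by apply/and3P; split; rewrite gt_eqF//; nra.
apply: (le_lt_trans (ler_pM (expR_ge0 _) (ltW c0) e3 c1)).
have v0 : 0 < u ^+ 2 by rewrite exprn_gt0.
have v1 : u ^+ 2 <= 4^-1 by nra.
have -> : u * t = 2 * u ^+ 2 by rewrite ut; field.
by rewrite -invfM invf_lt1; nra.
Qed.

(** Exponential Markov inequality, applied to each run of [2 ^ k] consecutive translates. The factor
    2 in front of [q ^+ k] counts the two tails. *)
Lemma sum_unbalanced (R : realType) (t : R) : 0 < t <= 1 ->
  exists2 q : R, 0 < q < 1 & forall (k n : nat) (x : R),
    \sum_(0 <= m < 2 ^ k * n) (unbalanced t k (x + m%:R))%:R
      <= (2 ^ k * n)%:R * (2 * q ^+ k) :> R.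
Proof.
move=> ht; have /andP[t0 t1] := ht.
exists (expR (- (t / 2 * t)) * ((expR (t / 2) + expR (- (t / 2))) / 2)).
  exact: chernoff_base.
set u := t / 2; move=> k; elim=> [|n IH] x.
  by rewrite muln0 big_geq// mul0r.
rewrite mulnS addnC (@big_cat_nat _ _ _ (2 ^ k * n))//= ?leq_addr//.
rewrite natrD [leRHS]mulrDl lerD// -{1}[(2 ^ k * n)%N]add0n big_addn addKn.
under eq_bigr => m _ do rewrite addnC natrD addrA.
set y := x + _.
have le_exp m : ((unbalanced t k (y + m%:R))%:R : R) <=
    expR (- (u * t)) ^+ k *
    (expR (u * ((odd_steps k (y + m%:R))%:R *+ 2 - k%:R)) +
     expR (- u * ((odd_steps k (y + m%:R))%:R *+ 2 - k%:R))).
  set d := _%:R *+ 2 - _; rewrite -expRM_natr mulrDr -!expRD /unbalanced -/d.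
  case: ltP => /= h; last by rewrite addr_ge0// expR_ge0.
  have u0 : 0 < u by rewrite /u; lra.
  have [d0|d0] := leP 0 d.
    rewrite ger0_norm// in h; rewrite -[leLHS]addr0 lerD ?expR_ge0//.
    rewrite -[leLHS]expR0 ler_expR (_ : _ + _ = u * (d - t * k%:R)); last by ring.
    by apply: mulr_ge0; rewrite ?subr_ge0 ltW.
  rewrite ltr0_norm// in h; rewrite -[leLHS]add0r lerD ?expR_ge0//.
  rewrite -[leLHS]expR0 ler_expR (_ : _ + _ = u * (- d - t * k%:R)); last by ring.
  by apply: mulr_ge0; rewrite ?subr_ge0 ltW.
apply: (le_trans (ler_sum _ (fun m _ => le_exp m))).
rewrite -big_distrr/= big_split/= !sum_odd_steps opprK.
rewrite [expR (- u) + _]addrC exprMn exprMn natrX -mulr2n -mulr_natl.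
rewrite exprVn le_eqVlt; apply/orP; left; apply/eqP; field.
by rewrite expf_neq0.
Qed.

(** * From counts over integer translates to Lebesgue measure *)

(** The right-hand side is a measure in [A] that gives half-open intervals their length, so
    uniqueness of Lebesgue measure applies. *)
Lemma lebesgue_measure_affine (R : realType) (a b : R) (A : set R) :
  0 < a -> measurable A ->
  lebesgue_measure A =
    (a%:E * lebesgue_measure [set x | A (a * x + b)%R])%E.
Proof.
move=> a0 mA.
pose f : measurableTypeR R -> measurableTypeR R := fun x => a * x + b.
have mf : measurable_fun [set: measurableTypeR R] f.
  by apply: measurable_funD => //; exact: mulrl_measurable.
pose mu := mscale (NngNum (ltW a0)) (pushforward (@lebesgue_measure R) f).
rewrite (@lebesgue_measure_unique R (mu mf))//.
move=> _ [[c d]] /= _ <-; rewrite /mu /mscale/= /pushforward.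
rewrite (_ : _ @^-1` _ = `](c - b) / a, (d - b) / a]%classic); last first.
  apply/seteqP; split=> x /=; rewrite /f !in_itv/= ltr_pdivrMr// ler_pdivlMr//;
    by move=> /andP[? ?]; apply/andP; split; lra.
rewrite !lebesgue_measure_itv/= !lte_fin ltr_pM2r ?invr_gt0// ltrD2r.
case: ifP => _; last by rewrite mule0.
by rewrite -!EFinB -EFinM; congr EFin; field; rewrite gt_eqF.
Qed.

Lemma measurable_odd_step (R : realType) :
  measurable_fun [set: R] (@odd_step R).
Proof.
apply: (measurable_fun_bool true); rewrite setTI.
pose F (n : int) : set R :=
  if (2 %| n)%Z then set0 else `]n%:~R - 2^-1, n%:~R + 2^-1]%classic.
rewrite (_ : _ @^-1` _ = \bigcup_n F n).
  apply: countable_bigcupT_measurable => // n; rewrite /F.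
  by case: ifP => // _; exact: measurable_itv.
apply/seteqP; split=> x /=.
  move=> xo; exists (nearest_int x) => //=; rewrite /F ifN//= in_itv/=.
  have /nearest_intP/andP[h1 h2] := erefl (nearest_int x).
  by apply/andP; split; lra.
move=> [n _]; rewrite /F; case: ifPn => //= no; rewrite in_itv/= => /andP[h1 h2].
rewrite /odd_step; have <- // : n = nearest_int x.
by apply/nearest_intP/andP; split; lra.
Qed.

Lemma measurable_collatz_real (R : realType) :
  measurable_fun [set: R] (@collatz_real R).
Proof.
rewrite (_ : @collatz_real R = fun x => if odd_step x then 3 * x / 2 else x / 2).
  apply: measurable_fun_ifT; first exact: measurable_odd_step.
    by do 2 apply: measurable_funM => //.
  by apply: measurable_funM.
by apply/funext => x; rewrite /collatz_real /odd_step; case: ifP.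
Qed.

Lemma measurable_iter_collatz_real (R : realType) (k : nat) :
  measurable_fun [set: R] (iter k (@collatz_real R)).
Proof.
elim: k => [|k IH]; first exact: measurable_id.
exact: measurableT_comp (measurable_collatz_real R) IH.
Qed.

Lemma measurable_odd_steps (R : realType) (k : nat) :
  measurable_fun [set: R] (fun x : R => (odd_steps k x)%:R : R).
Proof.
rewrite (_ : (fun x => _) =
    fun x : R => \sum_(i < k) (odd_step (iter i (@collatz_real R) x))%:R).
  apply: measurable_sum => i.
  apply: (measurableT_comp (f := fun b : bool => b%:R : R)) => //.
  exact: measurableT_comp (measurable_odd_step R) (measurable_iter_collatz_real R i).
by apply/funext => x; rewrite /odd_steps natr_sum.
Qed.

Lemma measurable_unbalanced (R : realType) (t : R) (k : nat) :
  measurable_fun [set: R] (unbalanced t k).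
Proof.
apply: measurable_fun_ltr => //; apply: measurableT_comp => //.
apply: measurable_funB => //.
rewrite (_ : (fun x => _) = fun x : R => (odd_steps k x)%:R + (odd_steps k x)%:R).
  by apply: measurable_funD; exact: measurable_odd_steps.
by apply/funext => x; rewrite mulr2n.
Qed.

(** The unit pieces of []0, N]] are translated onto []0, 1]]; the measure becomes the integral over
    []0, 1]] of the number of translates of [x] that lie in [A]. *)
Lemma lebesgue_measure_fold_le (R : realType) (A : set R) (N : nat) (c : R) :
  measurable A ->
  (forall x : R, \sum_(0 <= m < N) \1_A (x + m%:R) <= c) ->
  (lebesgue_measure (A `&` `]0%R, N%:R]) <= c%:E)%E.
Proof.
move=> mA sumA.
(* The factor [1] gives the form [a * x + b] of [lebesgue_measure_affine] at [a = 1]. *)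
pose B m := [set x : R | A (1 * x + m%:R)].
have mB m : measurable (B m).
  rewrite -[B m]setTI; apply: (@measurable_funD _ _ _ _ (fun x : R => 1 * x)) => //.
  exact: mulrl_measurable.
apply: (@le_trans _ _ (\sum_(0 <= m < N) lebesgue_measure (B m `&` `]0%R, 1%R]))%E).
  elim: N {sumA} => [|n IH]; first by rewrite set_itvoc0 setI0 measure0 big_geq.
  rewrite big_nat_recr//=; apply: (@le_trans _ _ (lebesgue_measure
      ((A `&` `]0%R, n%:R]) `|` (A `&` `]n%:R, n.+1%:R]))))%E.
    apply: le_measure; rewrite ?inE.
    - exact: measurableI.
    - by apply: measurableU; exact: measurableI.
    move=> x [Ax]; rewrite /= !in_itv/= => /andP[x0 xn].
    by have [h|h] := leP x n%:R; [left|right]; split=> //; apply/andP; split.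
  apply: (le_trans (measureU2 _ _ _)) => /=; try exact: measurableI.
  apply: leeD => //.
  rewrite (@lebesgue_measure_affine R 1 n%:R)// ?mul1e; last exact: measurableI.
  rewrite le_eqVlt; apply/orP; left; apply/eqP; congr lebesgue_measure.
  have e : n%:R + 1 = n.+1%:R :> R := natr1 n.
  apply/seteqP; split=> x [] /= Ax; rewrite /= !in_itv/= => /andP[? ?]; split=> //;
    apply/andP; split; lra.
rewrite (_ : (\sum_(_ <= _ < _) _)%E =
    (\sum_(0 <= m < N) \int[lebesgue_measure]_(x in `]0%R, 1%R]) (\1_(B m) x)%:E)%E).
  rewrite -ge0_integral_sum//=; last first.
    by move=> m; apply/measurable_EFinP; apply: measurable_indic; exact: mB.
  apply: (@le_trans _ _ (\int[lebesgue_measure]_(x in `]0%R, 1%R] : set R) (cst c%:E) x)%E).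
    apply: ge0_le_integral => //=.
    - by move=> x _; rewrite sume_ge0// => m _; rewrite lee_fin.
    - apply: emeasurable_sum => m.
      by apply/measurable_EFinP; apply: measurable_indic; exact: mB.
    - move=> x _; rewrite sumEFin lee_fin; apply: le_trans (sumA x).
      rewrite le_eqVlt; apply/orP; left; apply/eqP; apply: eq_bigr => m _.
      rewrite !indicE (_ : (x \in B m) = (x + m%:R \in A))//.
      by apply/idP/idP; rewrite !inE /B/= mul1r.
  rewrite integral_cst//= lebesgue_measure_itv/= lte_fin ltr01 oppr0 adde0.
  by rewrite mule1.
by apply: eq_bigr => m _; rewrite integral_indic//; exact: mB.
Qed.

(** The endpoint [y] is rounded up to a multiple of [2 ^ k], which costs at most the extra
    [2 ^+ k]. *)
Lemma lebesgue_measure_unbalanced_le (R : realType) (t : R) : 0 < t <= 1 ->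
  exists2 q : R, 0 < q < 1 & forall (k : nat) (y : R), 0 <= y ->
    (lebesgue_measure ([set x | unbalanced t k x] `&` `]0%R, y])
      <= ((y + 2 ^+ k) * (2 * q ^+ k))%:E)%E.
Proof.
move=> /sum_unbalanced[q q01 hq]; exists q => // k y y0.
have mU : measurable [set x : R | unbalanced t k x].
  by rewrite -[X in measurable X]setTI; apply: measurable_unbalanced.
pose n := (Num.truncn (y / 2 ^+ k)).+1.
have k0 : 0 < 2 ^+ k :> R by rewrite exprn_gt0.
have /andP[n1 n2] : y <= (2 ^ k * n)%:R <= y + 2 ^+ k.
  have /truncn_itv/andP[h1 h2] : 0 <= y / 2 ^+ k by rewrite divr_ge0// ltW.
  rewrite natrM natrX -ler_pdivrMl// mulrC (ltW h2)/=.
  by rewrite /n -(natr1 (Num.truncn _)) mulrDr mulr1 lerD2r mulrC -ler_pdivlMr.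
apply: (@le_trans _ _
    (lebesgue_measure ([set x | unbalanced t k x] `&` `]0%R, (2 ^ k * n)%:R])))%E.
  apply: le_measure; rewrite ?inE; try exact: measurableI.
  move=> x [Ux]; rewrite /= !in_itv/= => /andP[x0 xy]; split=> //=.
  by rewrite x0 (le_trans xy).
have /andP[q0 _] := q01.
apply: (@le_trans _ _ ((2 ^ k * n)%:R * (2 * q ^+ k))%:E); last first.
  by rewrite lee_fin ler_wpM2r// mulr_ge0// exprn_ge0// ltW.
apply: lebesgue_measure_fold_le => // x.
apply: le_trans (hq k n x); rewrite le_eqVlt; apply/orP; left; apply/eqP.
by apply: eq_bigr => m _; rewrite indicE mem_setE.
Qed.

(** * Measure of the points at which some block is unbalanced *)

Lemma measure_bigsetU_le_natmul d (T : measurableType d) (R : realType)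
    (mu : {measure set T -> \bar R}) (F : nat -> set T) (n : nat) (c : R) :
  (forall i, (i < n)%N -> measurable (F i)) ->
  (forall i, (i < n)%N -> (mu (F i) <= c%:E)%E) ->
  (mu (\big[setU/set0]_(i < n) F i) <= (n%:R * c)%:E)%E.
Proof.
move=> mF Fc; apply: (le_trans (Boole_inequality mu mF)).
apply: (@le_trans _ _ (\sum_(i < n) c%:E)%E).
  by apply: lee_sum => i _; exact: Fc.
by rewrite sumEFin sumr_const card_ord mulr_natl.
Qed.

Lemma measurable_odd_steps_eq (R : realType) (j s : nat) :
  measurable [set x : R | odd_steps j x = s].
Proof.
have -> : [set x : R | odd_steps j x = s] =
    (fun x => (odd_steps j x)%:R == s%:R :> R) @^-1` [set true].
  by apply/seteqP; split=> x /=; rewrite eqr_nat => /eqP.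
rewrite -[X in measurable X]setTI; apply: measurable_fun_eqr => //.
exact: measurable_odd_steps.
Qed.

Lemma measurable_unbalanced_iter (R : realType) (t : R) (j k : nat) :
  measurable [set x : R | unbalanced t k (iter j (@collatz_real R) x)].
Proof.
rewrite -[X in measurable X]setTI.
exact: (measurableT_comp (measurable_unbalanced _ t k)
  (measurable_iter_collatz_real R j)).
Qed.

(* On [odd_steps j x = s] the [j]-th iterate is the scaling by [3 ^ s / 2 ^ j],
   so the measure of the preimage is controlled by that of the image. *)
Lemma lebesgue_measure_odd_steps_unbalanced_le (R : realType) (t q : R) :
  (forall (k : nat) (y : R), 0 <= y ->
    (lebesgue_measure ([set x | unbalanced t k x] `&` `]0%R, y])
      <= ((y + 2 ^+ k) * (2 * q ^+ k))%:E)%E) ->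
  forall (j k s : nat) (r : R), 0 <= r ->
    (lebesgue_measure ([set x | odd_steps j x = s] `&`
        [set x | unbalanced t k (iter j (@collatz_real R) x)] `&` `]0%R, r[)
      <= ((r + 2 ^+ (j + k) / 3 ^+ s) * (2 * q ^+ k))%:E)%E.
Proof.
move=> hq j k s r r0; pose a : R := 3 ^+ s / 2 ^+ j.
have a0 : 0 < a by rewrite divr_gt0// exprn_gt0.
have mU : measurable ([set x : R | unbalanced t k x] `&` `]0%R, a * r]).
  apply: measurableI => //.
  by rewrite -[X in measurable X]setTI; apply: measurable_unbalanced.
have mV : measurable [set x : R |
    ([set x : R | unbalanced t k x] `&` `]0%R, a * r]) (a * x + 0)].
  rewrite -[X in measurable X]setTI.
  apply: (@measurable_funD _ _ _ _ (fun x : R => a * x) (cst 0)) => //.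
  exact: mulrl_measurable.
have := hq k _ (mulr_ge0 (ltW a0) r0).
rewrite (@lebesgue_measure_affine R a 0)// -lee_pdivlMl// -EFinM => h.
apply: le_trans (le_trans h _); last first.
  rewrite lee_fin le_eqVlt; apply/orP; left; apply/eqP; rewrite exprD /a; field.
  by rewrite !expf_neq0.
apply: le_measure; rewrite ?inE//.
  apply: measurableI => //; apply: measurableI.
    exact: measurable_odd_steps_eq.
  exact: measurable_unbalanced_iter.
move=> x [[/= xs Ux]]; rewrite !in_itv/= => /andP[x0 xr].
rewrite iter_collatz_real xs -/a in Ux; rewrite addr0; split=> //.
by rewrite mulr_gt0//= ler_wpM2l// ltW.
Qed.

(** Balance of the first [j] steps is part of the event: it bounds the number of odd steps from
    below, hence keeps the [j]-th iterate large. *)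
Definition new_unbalanced {R : realType} (t : R) (j k : nat) : set R :=
  [set x | ~~ unbalanced t j x &&
           unbalanced t k (iter j (@collatz_real R) x)].

Lemma measurable_new_unbalanced (R : realType) (t : R) (j k : nat) :
  measurable (new_unbalanced t j k : set R).
Proof.
have -> : new_unbalanced t j k = ~` [set x : R | unbalanced t j x] `&`
    [set x | unbalanced t k (iter j (@collatz_real R) x)].
  by apply/seteqP; split=> x /=; [case/andP=> /negP | case=> /negP h1 h2; apply/andP].
apply: measurableI; last exact: measurable_unbalanced_iter.
by apply: measurableC; rewrite -[X in measurable X]setTI; apply: measurable_unbalanced.
Qed.

(** Union over the [j.+1] possible values [s] of [odd_steps j x]. An unbalanced [s] contributes
    nothing; for the others the rounding term is at most [r], so each contributes at most
    [2 * r * (2 * q ^+ k)]. *)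
Lemma lebesgue_measure_new_unbalanced_le (R : realType) (t q : R) :
  0 < q -> (forall (k : nat) (y : R), 0 <= y ->
    (lebesgue_measure ([set x | unbalanced t k x] `&` `]0%R, y])
      <= ((y + 2 ^+ k) * (2 * q ^+ k))%:E)%E) ->
  forall (j k : nat) (r : R), 0 <= r ->
    (forall s : nat, `|s%:R *+ 2 - j%:R| <= t * j%:R ->
      2 ^+ (j + k) / 3 ^+ s <= r) ->
    (lebesgue_measure (new_unbalanced t j k `&` `]0%R, r[)
      <= (j.+1%:R * (4 * r * q ^+ k))%:E)%E.
Proof.
move=> q0 hq j k r r0 hs.
pose F s : set R := if t * j%:R < `|s%:R *+ 2 - j%:R| then set0 else
  [set x | odd_steps j x = s] `&`
  [set x | unbalanced t k (iter j (@collatz_real R) x)] `&` `]0%R, r[.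
have mF s : measurable (F s).
  rewrite /F; case: ifP => // _; apply: measurableI => //; apply: measurableI.
    exact: measurable_odd_steps_eq.
  exact: measurable_unbalanced_iter.
have qk : 0 <= q ^+ k by rewrite exprn_ge0// ltW.
apply: le_trans (measure_bigsetU_le_natmul _ _ _ lebesgue_measure F j.+1 _ _ _).
- apply: le_measure; rewrite ?inE.
  + by apply: measurableI => //; exact: measurable_new_unbalanced.
  + by apply: bigsetU_measurable => s _; exact: mF.
  move=> x [/andP[Bx Ux] xr]; rewrite -bigcup_mkord.
  exists (odd_steps j x); first by rewrite /= ltnS leq_odd_steps.
  by rewrite /F ifN.
- by move=> s _; exact: mF.
move=> s _; rewrite /F; case: ltP => [_|h].
  by rewrite measure0 lee_fin !mulr_ge0.
apply: le_trans (lebesgue_measure_odd_steps_unbalanced_le _ _ _ hq _ _ _ _ r0) _.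
have := hs s h; rewrite lee_fin; set z := _ / _ => zr.
have := mulr_ge0 (_ : 0 <= r - z) qk; rewrite subr_ge0 => /(_ zr); nra.
Qed.

Lemma lebesgue_measure_blocks_le (R : realType) (t q : R) :
  0 < q -> (forall (k : nat) (y : R), 0 <= y ->
    (lebesgue_measure ([set x | unbalanced t k x] `&` `]0%R, y])
      <= ((y + 2 ^+ k) * (2 * q ^+ k))%:E)%E) ->
  forall (J l : nat) (r : R), 0 <= r ->
    (forall j s : nat, (j < J)%N -> `|s%:R *+ 2 - (j * l)%:R| <= t * (j * l)%:R ->
      2 ^+ (j * l + l) / 3 ^+ s <= r) ->
    (lebesgue_measure (\big[setU/set0]_(j < J)
        (new_unbalanced t (j * l) l `&` `]0%R, r[))
      <= (J%:R * ((J * l).+1%:R * (4 * r * q ^+ l)))%:E)%E.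
Proof.
move=> q0 hq J l r r0 hs.
apply: (measure_bigsetU_le_natmul _ _ _ lebesgue_measure
  (fun j => new_unbalanced t (j * l) l `&` `]0%R, r[) J) => j jJ.
  by apply: measurableI => //; exact: measurable_new_unbalanced.
apply: le_trans (lebesgue_measure_new_unbalanced_le _ _ _ q0 hq _ _ _ r0 _) _.
  by move=> s; exact: hs.
rewrite lee_fin ler_wpM2r//; first by rewrite !mulr_ge0// exprn_ge0// ltW.
by rewrite ler_nat ltnS leq_mul2r ltnW ?orbT.
Qed.

(** * Size of the iterates in terms of the parity imbalance *)

Lemma ln2_gt0 (R : realType) : 0 < ln 2 :> R.
Proof. by rewrite ln_gt0// ltr1n. Qed.

Lemma ln3_gt0 (R : realType) : 0 < ln 3 :> R.
Proof. by rewrite ln_gt0// ltr1n. Qed.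

(* [3 ^ 5 < 2 ^ 8] *)
Lemma log2_3_lt (R : realType) : log2 3 < 8 / 5 :> R.
Proof.
have l2 := ln2_gt0 R.
rewrite /log2 ltr_pdivrMr// -(@ltr_pM2l _ 5)//.
have -> : 5 * (8 / 5 * ln 2) = ln 2 *+ 8 :> R by rewrite -mulr_natl; field.
rewrite mulr_natl -!lnXn// ltr_ln ?posrE ?exprn_gt0//.
by rewrite -!natrX ltr_nat.
Qed.

Lemma iter_collatz_real_bounds (R : realType) (eps x : R) (k : nat) : 0 < x ->
  `|(odd_steps k x)%:R *+ 2 - k%:R| * (ln 3 / 2) <= eps * ln x ->
  (3 `^ (1 / 2) / 2) ^+ k * x `^ (1 - eps) <= iter k (@collatz_real R) x
    <= (3 `^ (1 / 2) / 2) ^+ k * x `^ (1 + eps).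
Proof.
move=> x0; set s := odd_steps k x; set d := _ - _ => hd.
have powE (p y : R) : 0 < y -> y `^ p = expR (p * ln y).
  by move=> y0; rewrite /powR gt_eqF.
have l3 := ln3_gt0 R.
have e2 : 2 = expR (ln 2) :> R by rewrite lnK ?posrE.
have e3 : 3 = expR (ln 3) :> R by rewrite lnK ?posrE.
have -> : iter k (@collatz_real R) x =
    expR (s%:R * ln 3 - k%:R * ln 2 + ln x).
  by rewrite iter_collatz_real !expRD expRN !expRM_natl !lnK ?posrE.
have ex (p : R) : (3 `^ (1 / 2) / 2) ^+ k * x `^ p =
    expR (k%:R * (1 / 2 * ln 3 - ln 2) + p * ln x).
  by rewrite !powE// expRD expRM_natl expRB lnK// posrE.
rewrite !ex !ler_expR.
have sE : s%:R = d / 2 + k%:R / 2 by rewrite /d -mulr_natl; field.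
have := ler_norm d; have := ler_norm (- d); rewrite normrN sE => h1 h2.
have h3 : 0 < ln 3 / 2 :> R by rewrite divr_gt0.
have := ler_wpM2r (ltW h3) h1; have := ler_wpM2r (ltW h3) h2.
by move=> h4 h5; apply/andP; split; lra.
Qed.

(** The threshold [t * k] is additive in [k], so by the triangle inequality a balanced block extends
    a balanced prefix to a balanced prefix. *)
Lemma balanced_blocks (R : realType) (t x : R) (J l : nat) :
  (forall j, (j < J)%N -> ~ new_unbalanced t (j * l) l x) ->
  forall j, (j <= J)%N -> ~~ unbalanced t (j * l) x.
Proof.
move=> h; elim=> [|j IH] jJ.
  by rewrite mul0n /unbalanced /odd_steps big_ord0 mul0rn subrr normr0 mulr0 ltxx.
have IHj := IH (ltnW jJ).
have : ~~ unbalanced t l (iter (j * l) (@collatz_real R) x).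
  by apply/negP => h1; apply: (h j jJ); apply/andP.
move: IHj; rewrite /unbalanced -!leNgt mulSnr odd_stepsD !natrD => h1 h2.
rewrite mulrDr; apply: le_trans (lerD h1 h2); apply: le_trans (ler_normD _ _).
by rewrite le_eqVlt; apply/orP; left; apply/eqP; congr `| _ |; ring.
Qed.

Lemma odd_steps_deviationD (R : realType) (x : R) (j i : nat) :
  `|(odd_steps (j + i) x)%:R *+ 2 - (j + i)%:R| <=
  `|(odd_steps j x)%:R *+ 2 - j%:R| + i%:R :> R.
Proof.
rewrite odd_stepsD; set s := odd_steps i _.
have si : s%:R <= i%:R :> R by rewrite ler_nat leq_odd_steps.
have s0 : 0 <= s%:R :> R by [].
set d := (odd_steps j x)%:R *+ 2 - _.
have -> : (odd_steps j x + s)%:R *+ 2 - (j + i)%:R = d + (s%:R *+ 2 - i%:R).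
  by rewrite /d !natrD; ring.
apply: le_trans (ler_normD _ _) _; rewrite lerD2l ler_norml.
by apply/andP; split; lra.
Qed.

(** The imbalance at time [k] is compared with that at the last block boundary up to [k]: fewer than
    [l] steps remain inside the blocks, at most [b] after them. *)
Lemma odd_steps_deviation_le (R : realType) (t x b : R) (J l k : nat) :
  0 <= t -> (0 < l)%N -> (forall j, (j <= J)%N -> ~~ unbalanced t (j * l) x) ->
  0 <= b -> k%:R <= (J * l)%:R + b ->
  `|(odd_steps k x)%:R *+ 2 - k%:R| <= t * (J * l)%:R + l%:R + b.
Proof.
move=> t0 l0 h b0 kb.
have [kJ|kJ] := leqP k (J * l).
  have jJ : (k %/ l <= J)%N by rewrite -(mulnK J l0) leq_div2r.
  have := odd_steps_deviationD R x (k %/ l * l) (k %% l); rewrite -divn_eq => h1.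
  have := h _ jJ; rewrite /unbalanced -leNgt => h2.
  have h3 : t * (k %/ l * l)%:R <= t * (J * l)%:R.
    by rewrite ler_wpM2l// ler_nat leq_mul2r jJ orbT.
  have h4 : (k %% l)%:R <= l%:R :> R by rewrite ler_nat ltnW// ltn_mod.
  lra.
have := odd_steps_deviationD R x (J * l) (k - J * l); rewrite subnKC ?(ltnW kJ)// => h1.
have := h _ (leqnn J); rewrite /unbalanced -leNgt => h2.
have h3 : (k - J * l)%:R = k%:R - (J * l)%:R :> R by rewrite natrB// ltnW.
have h4 : 0 <= l%:R :> R by [].
lra.
Qed.

(** * Numerical choice of the block parameters *)

(** The linear factor is absorbed into the larger ratio [p = q * (2 - q)], which is below 1 since
    [1 - p = (1 - q) ^+ 2]; Bernoulli's inequality bounds [(2 - q) ^+ l] from below. *)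
Lemma natmul_expr_le (R : realType) (q : R) (J : nat) : 0 < q < 1 ->
  exists K p : R, [/\ 0 < K, 0 < p < 1 &
    forall l : nat, (J * l).+1%:R * q ^+ l <= K * p ^+ l].
Proof.
move=> /andP[q0 q1]; have h0 : 0 < 1 - q by rewrite subr_gt0.
exists (J%:R / (1 - q) + 1), (q * (1 + (1 - q))); split.
- by rewrite ltr_wpDl// divr_ge0// ltW.
- apply/andP; split; first by rewrite mulr_gt0//; lra.
  have : 0 < (1 - q) * (1 - q) by rewrite mulr_gt0.
  lra.
move=> l; have bern : 1 + (1 - q) * l%:R <= (1 + (1 - q)) ^+ l.
  elim: l => [|l IH]; first by rewrite mulr0 addr0 expr0.
  rewrite exprSr -natr1; have l0 : 0 <= l%:R :> R by [].
  have c0 : 0 <= 1 + (1 - q) by lra.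
  apply: le_trans (ler_wpM2r c0 IH); have := mulr_ge0 (mulr_ge0 (ltW h0) (ltW h0)) l0; lra.
rewrite exprMn mulrCA mulrC ler_wpM2l//; first by rewrite exprn_ge0// ltW.
apply: (@le_trans _ _ ((J%:R / (1 - q) + 1) * (1 + (1 - q) * l%:R))); last first.
  by rewrite ler_wpM2l// addr_ge0// divr_ge0// ltW.
rewrite -natr1 natrM mulrDl mul1r mulrDr mulr1 mulrA divfK ?gt_eqF//.
have := mulr_ge0 (ltW h0) (_ : 0 <= l%:R); rewrite ler0n => /(_ isT) h1.
have : 0 <= J%:R / (1 - q) by rewrite divr_ge0// ltW.
lra.
Qed.

(* [M / a] is the exponent of the time range, in units of [l], and [J] blocks of
   length [l] exhaust it up to a small proportion. *)
Lemma block_slack (R : realType) (eps t a M J l : R) :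
  0 < eps -> 5^-1 <= a -> 0 <= t -> t <= eps / 180 -> 42 / eps <= M ->
  30 / eps <= l -> (M - 1) / (a + t) < J + 1 -> J <= (M - 1) / (a + t) -> 0 <= J ->
  exists2 b : R, 0 <= b & a^-1 * (M * (l + 1)) <= J * l + b /\
    t * (J * l) + l + b <= eps / 2 * (M * l).
Proof.
move=> e0 a5 t0 te Me le J1 J2 J0.
have a0 : 0 < a by lra.
have M0 : 0 < M by apply: lt_le_trans Me; rewrite divr_gt0.
have l0 : 0 < l by apply: lt_le_trans le; rewrite divr_gt0.
have A5 : a^-1 <= 5 by rewrite -[leRHS]invrK lef_pV2 ?posrE ?invr_gt0.
have B5 : (a + t)^-1 <= 5.
  by rewrite -[leRHS]invrK lef_pV2 ?posrE ?invr_gt0//; lra.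
have A0 : 0 < a^-1 by rewrite invr_gt0.
have B0 : 0 < (a + t)^-1 by rewrite invr_gt0; lra.
have AB : a^-1 - (a + t)^-1 = t * (a^-1 * (a + t)^-1).
  by field; rewrite !gt_eqF//; lra.
move: A5 B5 A0 B0 AB J1 J2; set A := a^-1; set B := (a + t)^-1.
move=> A5 B5 A0 B0 AB J1 J2.
have AB25 : A * B <= 25 by have := ler_pM (ltW A0) (ltW B0) A5 B5; lra.
have AB1 : A - B <= t * 25 by rewrite AB ler_wpM2l.
have tM : 0 <= t * M by rewrite mulr_ge0// ltW.
have JM : J <= 5 * M.
  apply: (le_trans J2); apply: (@le_trans _ _ (M * B)).
    by rewrite ler_wpM2r ?ltW//; lra.
  by rewrite mulrC ler_wpM2r// ltW.
have AMJ : A * M - J <= 25 * (t * M) + 6.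
  have := ler_wpM2r (ltW M0) AB1.
  have : (M - 1) * B = M * B - B by ring.
  lra.
(* This is the bound for [(A * M - J) * l + A * M]: 25 comes from [A - B = t * (A * B)], 6 from the
   truncation of [J] and the [- 1] in [M - 1], and 5 from [A <= 5]. *)
exists ((25 * (t * M) + 6) * l + 5 * M).
  by rewrite addr_ge0// mulr_ge0 ?ltW//; lra.
split.
  have := ler_wpM2r (ltW l0) AMJ; have := ler_wpM2r (ltW M0) A5; lra.
have Ml0 : 0 <= M * l by rewrite mulr_ge0 ?ltW.
have tJ : t * (J * l) <= 5 * (t * (M * l)).
  have := ler_wpM2l t0 (ler_wpM2r (ltW l0) JM); lra.
have tMl : t * (M * l) <= eps / 180 * (M * l) by rewrite ler_wpM2r.
(* The total to bound is at most [30 * (t * (M * l)) + 7 * l + 5 * M]. The constants 180, 42 and 30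
   make each of the three terms at most [eps / 6 * (M * l)]. *)
have h7 : 42 * l <= eps * (M * l).
  rewrite mulrA ler_wpM2r ?(ltW l0)//; move: Me; rewrite ler_pdivrMr//; lra.
have h5 : 30 * M <= eps * (M * l).
  rewrite [M * l]mulrC mulrA ler_wpM2r ?(ltW M0)//.
  by move: le; rewrite ler_pdivrMr//; lra.
lra.
Qed.

(** The conclusion says that [3 ^+ s / 2 ^+ (j * l) * r] is at least [2 ^+ l]. In base 2 logarithms,
    balance gives [s >= (1 - t) * (j * l) / 2], so the prefix uses at most [(M - 1) * l] and the
    block itself the remaining [l]. *)
Lemma block_scale_le (R : realType) (t : R) (M J l j s : nat) (r : R) :
  0 <= t -> J%:R * (1 - log2 3 / 2 + t) <= M%:R - 1 ->
  2 ^+ (M * l) <= r -> (j < J)%N ->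
  `|s%:R *+ 2 - (j * l)%:R| <= t * (j * l)%:R ->
  2 ^+ (j * l + l) / 3 ^+ s <= r.
Proof.
move=> t0 hJ hr jJ; rewrite ler_norml => /andP[hs _].
apply: le_trans hr.
have l2 := ln2_gt0 R; have l3 := ln3_gt0 R; have l23 := log2_3_lt R.
have e3 : ln 3 = log2 3 * ln 2 :> R by rewrite /log2 divfK// gt_eqF.
have p2 (n : nat) : 0 < 2 ^+ n :> R by rewrite exprn_gt0.
have p3 : 0 < 3 ^+ s :> R by rewrite exprn_gt0.
rewrite -ler_ln ?posrE ?divr_gt0// ln_div ?posrE// !lnXn// e3.
rewrite -!(mulr_natr (ln 2)) -(mulr_natr (_ * ln 2)).
have -> : ln 2 * (j * l + l)%:R - log2 3 * ln 2 * s%:R =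
    ((j * l)%:R + l%:R - log2 3 * s%:R) * ln 2 :> R.
  by rewrite natrD; ring.
rewrite [leRHS]mulrC ler_wpM2r ?(ltW l2)//.
move: hs; set n := (j * l)%:R; set S := s%:R => hs.
have n0 : 0 <= n by [].
have L0 : 0 < log2 3 :> R by rewrite /log2 divr_gt0.
have h1 : log2 3 * ((1 - t) * n / 2) <= log2 3 * S.
  by rewrite ler_wpM2l ?(ltW L0)//; lra.
have h2 : n * (1 - log2 3 / 2 + t) <= (M%:R - 1) * l%:R.
  apply: (@le_trans _ _ (J%:R * (1 - log2 3 / 2 + t) * l%:R)); last by rewrite ler_wpM2r.
  rewrite /n natrM mulrAC ler_wpM2r// ler_wpM2r ?ler_nat// 1?ltnW//.
  lra.
have h3 : log2 3 / 2 * (t * n) <= 1 * (t * n).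
  by rewrite ler_wpM2r ?mulr_ge0//; lra.
rewrite natrM; lra.
Qed.

(** * The typical set and its measure at a given scale *)

Definition typical_set {R : realType} (eps : R) : set R :=
  [set x : R | 0 < x /\
    forall k : nat, k%:R <= 1 / (1 - log2 3 / 2) * log2 x ->
      (3 `^ (1 / 2) / 2) ^+ k * x `^ (1 - eps) <= iter k (@collatz_real R) x
        <= (3 `^ (1 / 2) / 2) ^+ k * x `^ (1 + eps)].

Lemma measurable_typical_set (R : realType) (eps : R) :
  measurable (typical_set eps).
Proof.
have mle (f g : R -> R) : measurable_fun setT f -> measurable_fun setT g ->
    measurable [set x | f x <= g x].
  move=> mf mg; rewrite -[X in measurable X]setTI.
  exact: (measurable_fun_ler mf mg).
pose P k := [set x : R | k%:R <= 1 / (1 - log2 3 / 2) * log2 x].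
pose Q p k := [set x : R | (3 `^ (1 / 2) / 2) ^+ k * x `^ p <= iter k (@collatz_real R) x].
pose Q' p k := [set x : R | iter k (@collatz_real R) x <= (3 `^ (1 / 2) / 2) ^+ k * x `^ p].
have -> : typical_set eps = `]0%R, +oo[%classic `&`
    \bigcap_k (~` P k `|` (Q (1 - eps) k `&` Q' (1 + eps) k)).
  apply/seteqP; split=> x /=.
    move=> [x0 h]; split; first by rewrite /= in_itv/= x0.
    move=> k _; have [hk|hk] := boolP (k%:R <= 1 / (1 - log2 3 / 2) * log2 x).
      by right; apply/andP; exact: h.
    by left; apply/negP.
  rewrite in_itv/= andbT => -[x0 h]; split=> // k hk.
  by have [//|[h1 h2]] := h k I; apply/andP.
have mlog : measurable_fun [set: R] (fun x : R => 1 / (1 - log2 3 / 2) * log2 x).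
  rewrite /log2; apply: measurable_funM => //; apply: measurable_funM => //.
have mpow p k : measurable_fun [set: R] (fun x : R => (3 `^ (1 / 2) / 2) ^+ k * x `^ p).
  by apply: measurable_funM => //; exact: measurable_powR.
apply: measurableI => //; apply: bigcap_measurableType => k _.
apply: measurableU; first by apply: measurableC; exact: mle.
by apply: measurableI; apply: mle => //; exact: measurable_iter_collatz_real.
Qed.

(** The upper bound on [x] limits the number of steps to what [block_slack] covers. The lower bound
    [Num.sqrt r < x] gives [ln x >= M * l / 2 * ln 2], so an imbalance of [eps / 2 * (M * l)] is
    affordable. *)
Lemma mem_typical_set (R : realType) (eps t r x : R) (M J l : nat) :
  0 < eps -> 0 <= t -> t <= eps / 180 -> 42 / eps <= M%:R -> 30 / eps <= l%:R ->
  J = Num.truncn ((M%:R - 1) / (1 - log2 3 / 2 + t)) ->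
  2 ^+ (M * l) <= r < 2 ^+ (M * l.+1) -> Num.sqrt r < x < r ->
  (forall j, (j < J)%N -> ~ new_unbalanced t (j * l) l x) ->
  typical_set eps x.
Proof.
move=> e0 t0 te Me le JE /andP[r1 r2] /andP[x1 x2] hJ.
have l2 := ln2_gt0 R; have l3 := ln3_gt0 R; have l23 := log2_3_lt R.
have r0 : 0 < r by apply: lt_le_trans r1; rewrite exprn_gt0.
have x0 : 0 < x by apply: le_lt_trans x1; rewrite sqrtr_ge0.
have lt0 : 0 < l%:R :> R by apply: lt_le_trans le; rewrite divr_gt0.
have M0 : 0 < M%:R :> R by apply: lt_le_trans Me; rewrite divr_gt0.
set a : R := 1 - log2 3 / 2 in JE.
(* This is where [log2 3 < 8 / 5] enters. *)
have a5 : 5^-1 <= a by rewrite /a; lra.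
have a0 : 0 < a by lra.
have l0 : (0 < l)%N by rewrite -(ltr_nat R).
have at0 : 0 < a + t by rewrite ltr_wpDr.
have M1 : 0 <= M%:R - 1 :> R by rewrite subr_ge0 ler1n -(ltr_nat R).
have /truncn_itv : 0 <= (M%:R - 1) / (a + t) by rewrite divr_ge0// ltW.
rewrite -JE -natr1 => /andP[J1 J2].
have [b b0 [hb1 hb2]] :=
  @block_slack R eps t a M%:R J%:R l%:R e0 a5 t0 te Me le J2 J1 (ler0n _ _).
split=> // k hk; apply: iter_collatz_real_bounds => //.
have lnx : M%:R * l%:R / 2 * ln 2 <= ln x.
  have : ln r <= 2 * ln x.
    rewrite mulr_natl -lnXn// ler_ln ?posrE ?exprn_gt0//.
    by rewrite -[leLHS]sqr_sqrtr ?(ltW r0)// ler_pXn2r// ?nnegrE ?sqrtr_ge0// ltW.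
  have : ln 2 *+ (M * l) <= ln r.
    by rewrite -lnXn// ler_ln ?posrE ?exprn_gt0.
  rewrite -(mulr_natr (ln 2)) natrM; lra.
have kJ : k%:R <= (J * l)%:R + b.
  apply: le_trans (_ : a^-1 * (M%:R * (l%:R + 1)) <= _); last by rewrite natrM.
  apply: (le_trans hk); rewrite div1r ler_wpM2l ?invr_ge0 ?(ltW a0)//.
  rewrite /log2 ler_pdivrMr//.
  have : ln x <= ln (2 ^+ (M * l.+1)).
    by rewrite ler_ln ?posrE ?exprn_gt0// ltW// (lt_trans x2).
  by rewrite lnXn// -(mulr_natl (ln 2)) natrM natr1.
have dev := odd_steps_deviation_le R t x b J l k t0 l0 (balanced_blocks R t x J l hJ) b0 kJ.
rewrite natrM in dev.
have {}dev := le_trans dev hb2.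
have e3 : ln 3 / 2 <= ln 2 :> R.
  have : log2 3 * ln 2 <= 2 * ln 2 :> R by rewrite ler_wpM2r ?(ltW l2)//; lra.
  by rewrite /log2 divfK ?gt_eqF//; lra.
have h3 : 0 <= ln 3 / 2 :> R by rewrite divr_ge0// ltW.
apply: (le_trans (ler_pM (normr_ge0 _) h3 dev e3)).
apply: le_trans (ler_wpM2l (ltW e0) lnx).
by rewrite le_eqVlt; apply/orP; left; apply/eqP; field.
Qed.

(** The interval []0, r[] is covered by its typical points, by []0, Num.sqrt r]] and by the points
    where some block is newly unbalanced. *)
Lemma lebesgue_measure_typical_set_ge (R : realType) (eps : R) : 0 < eps ->
  exists M l0 : nat, exists K p : R, [/\ (0 < M)%N, 0 < K, 0 < p < 1 &
    forall (l : nat) (r : R), (l0 <= l)%N ->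
      2 ^+ (M * l) <= r < 2 ^+ (M * l.+1) ->
      ((r - Num.sqrt r - K * p ^+ l * r)%:E <=
        lebesgue_measure ([set` `]0%R, r[] `&` typical_set eps))%E].
Proof.
move=> e0; pose t := Num.min 1 (eps / 180).
have t0 : 0 < t by rewrite lt_min ltr01 divr_gt0.
have t1 : t <= 1 by rewrite ge_min lexx.
have te : t <= eps / 180 by rewrite ge_min lexx orbT.
have [q q01 hq] := lebesgue_measure_unbalanced_le R t (introT andP (conj t0 t1)).
have [q0 q1] := andP q01.
pose M := (Num.truncn (42 / eps)).+1; pose l0 := (Num.truncn (30 / eps)).+1.
have leN (c : R) : 0 <= c -> c <= (Num.truncn c).+1%:R.
  by move=> /truncn_itv/andP[_ /ltW].
have Me : 42 / eps <= M%:R by apply: leN; rewrite divr_ge0// ltW.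
(* The number of blocks depends on [eps] alone, so [K] and [p] are the same at all scales [l]. *)
pose J := Num.truncn ((M%:R - 1) / (1 - log2 3 / 2 + t)).
have [K [p [K0 p01 hK]]] := natmul_expr_le R q J q01.
(* Taking [J.+1] keeps the constant positive even when [J = 0]. *)
exists M, l0, (J.+1%:R * 4 * K), p; split=> //.
  by rewrite !mulr_gt0.
move=> l r ll0 hr; have /andP[r1 r2] := hr.
have r0 : 0 < r by apply: lt_le_trans r1; rewrite exprn_gt0.
have le : 30 / eps <= l%:R.
  by apply: le_trans (leN _ _) _; rewrite ?divr_ge0 ?ler_nat// ltW.
have l23 := log2_3_lt R.
have at0 : 0 < 1 - log2 3 / 2 + t by lra.
have M1 : 0 <= M%:R - 1 :> R by rewrite subr_ge0 ler1n.
have hJ : J%:R * (1 - log2 3 / 2 + t) <= M%:R - 1.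
  rewrite -ler_pdivlMr//.
  have /truncn_itv/andP[//] : 0 <= (M%:R - 1) / (1 - log2 3 / 2 + t).
  by rewrite divr_ge0// ltW.
have hE := lebesgue_measure_blocks_le R t q q0 hq J l r (ltW r0)
  (fun j s => block_scale_le R t M J l j s r (ltW t0) hJ r1).
set E := \big[_/_]_(_ < _) _ in hE.
set S := [set` _] `&` _.
have mS : measurable S by apply: measurableI => //; exact: measurable_typical_set.
have mE : measurable E.
  apply: bigsetU_measurable => j _; apply: measurableI => //.
  exact: measurable_new_unbalanced.
have sr0 := sqrtr_ge0 r.
have cover : ((r)%:E <= lebesgue_measure S + (Num.sqrt r)%:E +
    (J%:R * ((J * l).+1%:R * (4 * r * q ^+ l)))%:E)%E.
  have -> : r%:E = lebesgue_measure (`]0%R, r[ : set R).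
    by rewrite lebesgue_measure_itv/= lte_fin r0 oppr0 adde0.
  have -> : (Num.sqrt r)%:E = lebesgue_measure (`]0%R, Num.sqrt r] : set R).
    rewrite lebesgue_measure_itv/= lte_fin oppr0 adde0.
    by rewrite sqrtr_gt0 r0.
  apply: (@le_trans _ _ (lebesgue_measure ((S `|` `]0%R, Num.sqrt r]) `|` E))).
    apply: le_measure; rewrite ?inE//.
      by apply: measurableU => //; exact: measurableU.
    move=> x xr; have := xr; rewrite /= in_itv/= => /andP[x0 x2].
    have [x1|x1] := leP x (Num.sqrt r); first by left; right; rewrite /= in_itv/= x0.
    have [Ex|nEx] := pselect (E x); first by right.
    left; left; split=> //.
    apply: (@mem_typical_set R eps t r x M J l) => //; [exact: ltW|by rewrite x1|].
    move=> j jJ hj; apply: nEx; rewrite /E.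
    rewrite -(bigcup_mkord J (fun j => new_unbalanced t (j * l) l `&` `]0%R, r[)).
    by exists j.
  apply: (le_trans (measureU2 _ _ _)) => //; first exact: measurableU.
  apply: leeD hE; exact: measureU2.
move: cover; case: (lebesgue_measure S) (measure_ge0 lebesgue_measure S) => [m||]//=.
  rewrite -!EFinD !lee_fin => _ cov.
  have h1 : J%:R * ((J * l).+1%:R * (4 * r * q ^+ l)) <= J%:R * 4 * r * (K * p ^+ l).
    have : 0 <= J%:R * 4 * r by rewrite !mulr_ge0// ltW.
    move=> /ler_wpM2l/(_ _ _ (hK l)) h; apply: le_trans h.
    by rewrite le_eqVlt; apply/orP; left; apply/eqP; ring.
  have h2 : 0 <= 4 * r * (K * p ^+ l).
    by have /andP[p0 _] := p01; rewrite !mulr_ge0 ?exprn_ge0// ltW.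
  by rewrite -natr1; lra.
by move=> _ _; rewrite leey.
Qed.

(** * From exponential decay in [l] to a power of [r] *)

Lemma exists_dyadic_block (R : realType) (M l0 : nat) (r : R) : (0 < M)%N ->
  2 ^+ (M * l0) <= r ->
  exists2 l : nat, (l0 <= l)%N & 2 ^+ (M * l) <= r < 2 ^+ (M * l.+1).
Proof.
move=> M0 r0; have r_gt0 : 0 < r by apply: lt_le_trans r0; rewrite exprn_gt0.
have l2 := ln2_gt0 R.
have Ml2 : 0 < M%:R * ln 2 :> R by rewrite mulr_gt0// ltr0n.
have lnr0 : (M * l0)%:R * ln 2 <= ln r.
  by rewrite mulr_natl -lnXn// ler_ln ?posrE ?exprn_gt0.
have q0 : 0 <= ln r / (M%:R * ln 2).
  by rewrite divr_ge0 ?(ltW Ml2)// (le_trans _ lnr0)// mulr_ge0// ltW.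
exists (Num.truncn (ln r / (M%:R * ln 2))).
  by rewrite truncn_ge_nat// ler_pdivlMr// mulrA -natrM mulnC.
have /truncn_itv := q0; set l := Num.truncn _.
rewrite ler_pdivlMr// ltr_pdivrMr// => /andP[l1 l1'].
rewrite -ler_ln ?posrE ?exprn_gt0// -ltr_ln ?posrE ?exprn_gt0// !lnXn//.
by rewrite -!(mulr_natl (ln 2)) !natrM ![M%:R * _]mulrC -!mulrA l1 l1'.
Qed.

Theorem theorem1p6 (R : realType) (eps : R) (heps : 0 < eps) :
  real_star_dense [set x : R | 0 < x /\
    forall k : nat, k%:R <= 1 / (1 - log2 3 / 2) * log2 x ->
      (3 `^ (1 / 2) / 2) ^+ k * x `^ (1 - eps) <= iter k (@collatz_real R) x
        <= (3 `^ (1 / 2) / 2) ^+ k * x `^ (1 + eps)].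
Proof.
have [M [l0 [K [p [M0 K0 /andP[p0 p1] h]]]]] := lebesgue_measure_typical_set_ge R eps heps.
have mS := measurable_typical_set R eps.
have l2 := ln2_gt0 R.
have Ml2 : 0 < M%:R * ln 2 :> R by rewrite mulr_gt0// ltr0n.
have [D [D0 D2 Dp]] :
    exists D : R, [/\ 0 < D, D <= 2^-1 & D * (M%:R * ln 2) <= - ln p].
  exists (Num.min 2^-1 (- ln p / (M%:R * ln 2))); split.
  - by rewrite lt_min invr_gt0 ltr0n/= divr_gt0// oppr_gt0 ln_lt0// p0.
  - by rewrite ge_min lexx.
  - by rewrite -ler_pdivlMr// ge_min lexx orbT.
have [r0 r0E] : exists r0 : R, r0 = 2 ^+ (M * l0) by eexists.
have r00 : 0 < r0 by rewrite r0E exprn_gt0.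
have c2 : 0 < 2 `^ (D * M%:R) :> R by rewrite powR_gt0.
have c3 : 0 < r0 `^ D by rewrite powR_gt0.
have Kc : 0 < K * 2 `^ (D * M%:R) by rewrite mulr_gt0.
(* The three summands pay for [Num.sqrt r], for the unbalanced points, and for [r < r0], where the
   last one makes the required lower bound nonpositive. *)
exists (1 + K * 2 `^ (D * M%:R) + r0 `^ D), D; split.
- exists (typical_set eps) => //; exists set0; first exact: negligible_set0.
  by rewrite setU0.
- by rewrite !addr_gt0.
- by rewrite D0 (le_lt_trans D2)// invf_lt1 ?ltr1n.
move=> r r_gt0; rewrite -/(typical_set eps).
have -> : completed_lebesgue_measure ([set` `]0%R, r[] `&` typical_set eps) =
  lebesgue_measure ([set` `]0%R, r[] `&` typical_set eps) by [].
have rD : 0 < r `^ D by rewrite powR_gt0.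
rewrite inver gt_eqF// lee_pdivlMr// -EFinM.
have [rr0|rr0] := ltP r r0.
  apply: (@le_trans _ _ 0%E); last exact: measure_ge0.
  rewrite lee_fin pmulr_lle0// subr_le0 ler_pdivlMr// mul1r.
  apply: (@le_trans _ _ (r0 `^ D)); last by rewrite lerDr ltW// addr_gt0.
  by apply: ge0_ler_powR; rewrite ?nnegrE ltW.
have [l ll0 rl] : exists2 l : nat, (l0 <= l)%N & 2 ^+ (M * l) <= r < 2 ^+ (M * l.+1).
  by apply: exists_dyadic_block => //; rewrite -r0E.
apply: le_trans (h l r ll0 rl); rewrite lee_fin.
have r1 : 1 <= r by apply: le_trans rr0; rewrite r0E exprn_ege1// ler1n.
have sq : Num.sqrt r <= (r `^ D)^-1 * r.
  have -> : (r `^ D)^-1 * r = r `^ (1 - D).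
    by rewrite powRB ?(gt_eqF r_gt0) ?implybT// powRr1 1?mulrC// ltW.
  rewrite -powR12_sqrt ?(ltW r_gt0)//; apply: ler_powR => //.
  by clear -D2; lra.
have pl : p ^+ l <= 2 `^ (D * M%:R) * (r `^ D)^-1.
  have lr : ln r <= M%:R * (l%:R + 1) * ln 2.
    rewrite natr1 -natrM mulr_natl -lnXn// ler_ln ?posrE ?exprn_gt0//.
    by have /andP[_ /ltW] := rl.
  rewrite -powRN /powR !gt_eqF// -expRD -[p in p ^+ l]lnK ?posrE// -expRM_natl ler_expR.
  have := ler_wpM2r (ler0n R l) Dp.
  have := ler_wpM2l (ltW D0) lr.
  by clear; lra.
have := ler_wpM2r (ltW r_gt0) (ler_wpM2l (ltW K0) pl).
have : 0 < r0 `^ D * (r `^ D)^-1 * r by rewrite !mulr_gt0 ?invr_gt0.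
move: sq; clear; lra.
Qed.
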